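(* For every positive integer $n$, the virtual Gauss braid group $GVB_n$ is linear.
   Context: The virtual braid group $VB_n$ is the group with generators $\sigma_1,\dots,\sigma_{n-1},\rho_1,\dots,\rho_{n-1}$ and defining relations: (R1) $\sigma_i\sigma_{i+1}\sigma_i=\sigma_{i+1}\sigma_i\sigma_{i+1}$ for $1\le i\le n-2$; (R2) $\sigma_i\sigma_j=\sigma_j\sigma_i$ for $|i-j|\ge 2$; (R3) $\rho_i\rho_{i+1}\rho_i=\rho_{i+1}\rho_i\rho_{i+1}$ for $1\le i\le n-2$; (R4) $\rho_i\rho_j=\rho_j\rho_i$ for $|i-j|\ge 2$; (R5) $\rho_i^2=1$ for $1\le i\le n-1$; (R6) $\sigma_i\rho_j=\rho_j\sigma_i$ for $|i-j|\ge 2$; (M) $\rho_i\rho_{i+1}\sigma_i=\sigma_{i+1}\rho_i\rho_{i+1}$ for $1\le i\le n-2$. The flat virtual braid group $FVB_n$ is the quotient of $VB_n$ by the relations $\sigma_i^2=1$ for $1\le i\le n-1$; the image of $\sigma_i$ is denoted $s_i$ and the image of $\rho_i$ is still denoted $\rho_i$. The virtual Gauss braid group $GVB_n$ is the quotient of $FVB_n$ by the relations $s_i\rho_i=\rho_is_i$ for $1\le i\le n-1$. A group is linear if it admits a faithful finite-dimensional linear representation over a field. *)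

(* Defs.v *)
From HB Require Import structures.
From mathcomp Require Import all_boot all_algebra.
From mathcomp Require Import boolp.

Set Implicit Arguments.
Unset Strict Implicit.
Unset Printing Implicit Defensive.

Import GRing.Theory.

Local Open Scope group_scope.
Local Open Scope quotient_scope.

(* The words in the letters x and x^-1, for x : X; (x, true) stands for x and *)
(* (x, false) for x^-1.  Words form a monoid under concatenation; inversion   *)
(* reverses a word and flips its signs, and x * x^-1 is not reduced.          *)
Definition word (X : choiceType) : Type := seq (X * bool).

HB.instance Definition _ (X : choiceType) := Choice.on (word X).

Section Word.
Variable X : choiceType.

Definition flip (l : X * bool) : X * bool := (l.1, ~~ l.2).
Definition word_inv (w : word X) : word X := rev (map flip w).

Fact word_mulA : associative (@cat (X * bool) : word X -> word X -> word X).
Proof. exact: catA. Qed.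

Fact word_mul1w : left_id ([::] : word X) (@cat (X * bool)).
Proof. exact: cat0s. Qed.

Fact word_invK : involutive word_inv.
Proof.
move=> w; rewrite /word_inv map_rev revK -map_comp.
by apply: map_id_in => -[x b] _; rewrite /flip /= negbK.
Qed.

Fact word_invM : {morph word_inv : u v / u ++ v >-> v ++ u}.
Proof. by move=> u v; rewrite /word_inv map_cat rev_cat. Qed.

HB.instance Definition _ :=
  isStarMonoid.Build (word X) word_mulA word_mul1w word_invK word_invM.

Definition letter (x : X) : word X := [:: (x, true)].

End Word.

(* The group obtained from M by imposing the relations u = v for R u v: when  *)
(* M = word X it is the group presented by < X | R >, and when M is a group   *)
(* it is the quotient of M by the normal closure of the u * v^-1 for R u v.   *)
Section GroupQuotient.
Variables (M : starMonoidType) (R : M -> M -> Prop).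

Inductive congr_closure : M -> M -> Prop :=
| congr_rel u v : R u v -> congr_closure u v
| congr_mulV u : congr_closure (u * u^-1) 1
| congr_refl u : congr_closure u u
| congr_sym u v : congr_closure u v -> congr_closure v u
| congr_trans v u w :
    congr_closure u v -> congr_closure v w -> congr_closure u w
| congr_mul u u' v v' :
    congr_closure u u' -> congr_closure v v' ->
    congr_closure (u * v) (u' * v').

Definition congrb : rel M := fun u v => `[< congr_closure u v >].

Fact congrb_refl : reflexive congrb.
Proof. by move=> u; apply/asboolP/congr_refl. Qed.

Fact congrb_sym : symmetric congrb.
Proof. by move=> u v; apply/asboolP/asboolP => /congr_sym. Qed.

Fact congrb_trans : transitive congrb.
Proof.
by move=> v u w /asboolP uv /asboolP vw; apply/asboolP/(congr_trans uv vw).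
Qed.

Canonical congrb_equiv := EquivRel congrb congrb_refl congrb_sym congrb_trans.

Definition gquot : Type := {eq_quot congrb}.

HB.instance Definition _ := Choice.on gquot.
HB.instance Definition _ := EqQuotient.on gquot.

Definition gquot_pi (u : M) : gquot := \pi_gquot u.

Lemma gquot_piP (u v : M) : gquot_pi u = gquot_pi v <-> congr_closure u v.
Proof.
split=> [/eqmodP/asboolP //| uv]; exact/eqmodP/asboolP.
Qed.

Lemma gquot_reprK : cancel repr gquot_pi.
Proof. exact: reprK. Qed.

Definition gquot_one : gquot := gquot_pi 1.
Definition gquot_mul (x y : gquot) : gquot := gquot_pi (repr x * repr y).
Definition gquot_inv (x : gquot) : gquot := gquot_pi (repr x)^-1.

Lemma gquot_mulE u v : gquot_mul (gquot_pi u) (gquot_pi v) = gquot_pi (u * v).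
Proof. by apply/gquot_piP/congr_mul; apply/gquot_piP/gquot_reprK. Qed.

Lemma congr_Vmul u : congr_closure (u^-1 * u) 1.
Proof. by rewrite -{2}[u]invgK; apply: congr_mulV. Qed.

Lemma gquot_invE u : gquot_inv (gquot_pi u) = gquot_pi u^-1.
Proof.
apply/gquot_piP; set v := repr _.
have uv : congr_closure v u by apply/gquot_piP/gquot_reprK.
have vuV : congr_closure (v^-1 * u * u^-1) u^-1.
  rewrite -{2}[u^-1]mul1g; apply: congr_mul (congr_refl _).
  exact: congr_trans (congr_mul (congr_refl _) (congr_sym uv)) (congr_Vmul _).
apply: congr_trans vuV; rewrite -mulgA -{1}[v^-1]mulg1.
exact: congr_mul (congr_refl _) (congr_sym (congr_mulV _)).
Qed.

Fact gquot_mulA : associative gquot_mul.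
Proof.
move=> x y z; rewrite -[x]gquot_reprK -[y]gquot_reprK -[z]gquot_reprK.
by rewrite !gquot_mulE mulgA.
Qed.

Fact gquot_mul1g : left_id gquot_one gquot_mul.
Proof. by move=> x; rewrite -[x]gquot_reprK gquot_mulE mul1g. Qed.

Fact gquot_mulg1 : right_id gquot_one gquot_mul.
Proof. by move=> x; rewrite -[x]gquot_reprK gquot_mulE mulg1. Qed.

Fact gquot_mulVg : left_inverse gquot_one gquot_inv gquot_mul.
Proof.
move=> x; rewrite -[x]gquot_reprK gquot_invE gquot_mulE.
exact/gquot_piP/congr_Vmul.
Qed.

Fact gquot_mulgV : right_inverse gquot_one gquot_inv gquot_mul.
Proof.
move=> x; rewrite -[x]gquot_reprK gquot_invE gquot_mulE.
exact/gquot_piP/congr_mulV.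
Qed.

HB.instance Definition _ := isGroup.Build gquot
  gquot_mulA gquot_mul1g gquot_mulg1 gquot_mulVg gquot_mulgV.

End GroupQuotient.

(* The braid indices 1 .. n-1 are shifted to 0 .. n-2, the values of 'I_n.-1. *)
Definition VB_gen (n : nat) : choiceType := ('I_n.-1 + 'I_n.-1)%type.

Definition sigma_ (n : nat) (i : 'I_n.-1) : word (VB_gen n) :=
  letter (inl i : VB_gen n).
Definition rho_ (n : nat) (i : 'I_n.-1) : word (VB_gen n) :=
  letter (inr i : VB_gen n).

Definition far (n : nat) (i j : 'I_n.-1) : bool := (i.+2 <= j) || (j.+2 <= i).

Inductive VB_rel (n : nat) : word (VB_gen n) -> word (VB_gen n) -> Prop :=
| VB_R1 (i j : 'I_n.-1) : j = i.+1 :> nat ->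
    VB_rel (sigma_ i * sigma_ j * sigma_ i) (sigma_ j * sigma_ i * sigma_ j)
| VB_R2 (i j : 'I_n.-1) : far i j ->
    VB_rel (sigma_ i * sigma_ j) (sigma_ j * sigma_ i)
| VB_R3 (i j : 'I_n.-1) : j = i.+1 :> nat ->
    VB_rel (rho_ i * rho_ j * rho_ i) (rho_ j * rho_ i * rho_ j)
| VB_R4 (i j : 'I_n.-1) : far i j ->
    VB_rel (rho_ i * rho_ j) (rho_ j * rho_ i)
| VB_R5 (i : 'I_n.-1) : VB_rel (rho_ i ^+ 2) 1
| VB_R6 (i j : 'I_n.-1) : far i j ->
    VB_rel (sigma_ i * rho_ j) (rho_ j * sigma_ i)
| VB_M (i j : 'I_n.-1) : j = i.+1 :> nat ->
    VB_rel (rho_ i * rho_ j * sigma_ i) (sigma_ j * rho_ i * rho_ j).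

Definition VB (n : nat) : groupType := gquot (@VB_rel n).

Inductive FVB_rel (n : nat) : VB n -> VB n -> Prop :=
| FVB_sigma2 (i : 'I_n.-1) :
    FVB_rel (gquot_pi (@VB_rel n) (sigma_ i) ^+ 2) 1.

Definition FVB (n : nat) : groupType := gquot (@FVB_rel n).

Definition FVB_s (n : nat) (i : 'I_n.-1) : FVB n :=
  gquot_pi (@FVB_rel n) (gquot_pi (@VB_rel n) (sigma_ i)).
Definition FVB_rho (n : nat) (i : 'I_n.-1) : FVB n :=
  gquot_pi (@FVB_rel n) (gquot_pi (@VB_rel n) (rho_ i)).

Inductive GVB_rel (n : nat) : FVB n -> FVB n -> Prop :=
| GVB_comm (i : 'I_n.-1) :
    GVB_rel (FVB_s i * FVB_rho i) (FVB_rho i * FVB_s i).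

Definition GVB (n : nat) : groupType := gquot (@GVB_rel n).

(* Since r 1 = 1%:M and r is multiplicative, r x is always invertible, so r   *)
(* is a homomorphism from G to GL_d(K).                                       *)
Definition linear_repr (K : fieldType) (d : nat) (G : groupType)
    (r : G -> 'M[K]_d) : Prop :=
  r 1 = 1%:M%R /\ {morph r : x y / x * y >-> (x *m y)%R}.

Definition linear_group (G : groupType) : Prop :=
  exists (K : fieldType) (d : nat) (r : G -> 'M[K]_d),
    linear_repr r /\ injective r.

(* Main.v *)
(* GVB_n is the semidirect product of the symmetric group S_n, generated by   *)
(* the rho_i, and the normal closure of the s_i.  The conjugates of the s_i   *)
(* by S_n are indexed by the edges {a, b} of the complete graph on n          *)
(* vertices, since s_i commutes with rho_i; they satisfy the relations of a   *)
(* simply laced Coxeter group, two edges braiding when they share exactly one *)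
(* vertex and commuting when they are disjoint.  S_n permutes the edges and   *)
(* preserves the Tits form, so the geometric representation of the Coxeter    *)
(* group extends to GVB_n; adding the permutation representation makes it     *)
(* faithful, by the theorem of Tits.  That theorem is applied twice, to the   *)
(* edge reflections and to the rho_i: if l(sw) > l(w) then w maps alpha_s to  *)
(* a positive root, by induction on l(w).                                     *)
Require Import Defs.
From mathcomp Require Import all_boot all_order all_fingroup all_algebra.
From mathcomp Require Import zify ring.

Set Implicit Arguments.
Unset Strict Implicit.
Unset Printing Implicit Defensive.

Import Order.TTheory GRing.Theory Num.Theory.

Local Open Scope group_scope.

(** Conjugating the [s_i] by the [rho_i] yields reflections indexed by the edges of the complete
    graph, permuted by the [rho_i] as by adjacent transpositions ([refl_nat_conj]). The mixed
    relation makes two constructions of the edge [{i, i+2}] agree, and the Gauss relation says that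
    swapping the ends of an edge fixes its reflection. Hence every element is a product [w] of edge
    reflections times a product [v] of [rho_i] ([GVB_normal_form]).

    The representation acts on the space spanned by all sets of vertices: [rho_i] permutes them, and
    an edge acts by the reflection formula on edges and trivially on other sets. If [w * v] acts as
    the identity, the singletons show that the permutation of [v] is trivial, so [v = 1] by
    [perm_prod_faithful], and then [w = 1] by [edge_refl_faithful]. Both lemmas are instances of
    [simply_laced_faithful], whose hypotheses are relations holding in the ambient group and the
    action of generators on roots, so it applies to products taken inside [GVB] itself. *)

(** * Faithfulness of simply laced Coxeter groups *)

(* [u] and [v] are the roots of the reflections [x] and [y]; the case [x = y] *)
(* is kept so that a family of generators may have repetitions.               *)
Variant coxeter_pair (G : groupType) (K : numFieldType) (d : nat)
    (f : G -> 'M[K]_d) (x y : G) (u v : 'rV[K]_d) : Prop :=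
| CoxeterEq of x = y
| CoxeterComm of (u *m f y = u)%R & x * y = y * x
| CoxeterBraid of (u *m f y = u + v)%R & (v *m f x = u + v)%R
    & x * y * x = y * x * y.

Section SimplyLaced.
Variables (G : groupType) (K : numFieldType) (d : nat) (f : G -> 'M[K]_d).
Variables (I : Type) (g : I -> G) (alpha : I -> 'rV[K]_d) (phi : 'cV[K]_d).
Hypothesis f_repr : linear_repr f.
Hypothesis g2 : forall s, g s * g s = 1.
Hypothesis phi_gt0 : forall s, (0 < (alpha s *m phi) 0 0)%R.
Hypothesis alphaN : forall s, (alpha s *m f (g s) = - alpha s)%R.

Hypothesis gP : forall s t, coxeter_pair f (g s) (g t) (alpha s) (alpha t).

Local Notation wprod w := (\prod_(s <- w) g s).

Definition reduced (w : seq I) : Prop :=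
  forall u, wprod u = wprod w -> size w <= size u.

Let positive x s := (0 < (alpha s *m f x *m phi) 0 0)%R.

Let f1 : f 1 = 1%:M%R. Proof. by case: f_repr. Qed.
Let fM x y : f (x * y) = (f x *m f y)%R. Proof. by case: f_repr => _ ->. Qed.
Let gK s x : g s * (g s * x) = x. Proof. by rewrite mulgA g2 mul1g. Qed.

Lemma reduced_cons t w : reduced (t :: w) -> reduced w.
Proof.
by move=> red u eq_u; rewrite -ltnS; apply: (red (t :: u)); rewrite !big_cons eq_u.
Qed.

(* The root dichotomy, in the weak form where the positivity of a root is     *)
(* tested by the single linear form phi.                                      *)
Lemma reduced_positive w s : reduced w ->
  positive (wprod w) s \/
  exists2 u, size u < size w & wprod w = g s * wprod u.
Proof.
elim: {w}_.+1 {-2}w s (ltnSn (size w)) => // n IHn [|t w] s /= w_n red.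
  by left; rewrite /positive big_nil f1 mulmx1.
have redw := reduced_cons red.
case: (gP s t) => [st | fix_s st | fs ft braid].
- by right; exists w => //; rewrite big_cons st.
- case: (IHn w s _ redw) => // [pos | [u u_w eq_u]].
    by left; rewrite /positive big_cons fM mulmxA fix_s.
  by right; exists (t :: u); rewrite // !big_cons eq_u !mulgA st.
have posP x : positive x s -> positive x t -> positive (g t * x) s.
  by rewrite /positive fM mulmxA fs !mulmxDl => p q; rewrite [ltRHS]mxE addr_gt0.
(* A negative image of the root of [t] would let [t] cancel, against the minimality of [t :: w]. *)
case: (IHn w t _ redw) => // [pos_t | [u u_w eq_u]]; last first.
  by have /(_ u) := red; rewrite big_cons eq_u gK leqNgt ltnW // => /(_ erefl).
case: (IHn w s _ redw) => // [pos_s | [u u_w eq_u]].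
  by left; rewrite big_cons; apply: posP.
have redu : reduced u.
  move=> v eq_v; rewrite -ltnS (leq_trans u_w) //.
  by apply: (redw (s :: v)); rewrite big_cons eq_v eq_u.
case: (IHn u t _ redu) => [|pos_u | [v v_u eq_v]].
- exact: ltn_trans u_w w_n.
(* Applying [t], then [s], sends [alpha s] to [alpha s + alpha t], then to [alpha t]; only [alpha t]
   under [u] remains. *)
- left; rewrite /positive big_cons eq_u !fM !mulmxA fs mulmxDl alphaN ft.
  by rewrite addKr.
(* Here the word is [t s t v], and the braid relation rewrites it as [s t s v]. *)
right; exists (t :: s :: v) => /=; first exact: leq_ltn_trans v_u _.
by rewrite !big_cons eq_u eq_v !mulgA braid.
Qed.

(** A shortest word [s :: w] acting trivially would make [w] act as [g s], hence send [alpha s] to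
    its opposite. By [reduced_positive], [w] could then be rewritten to start with [s], which
    shortens the word. *)
Lemma simply_laced_faithful w : f (wprod w) = 1%:M%R -> wprod w = 1.
Proof.
elim: {w}_.+1 {-2}w (ltnSn (size w)) => // n IHn w w_n fw1.
have [//|] := boolp.EM (exists2 u, size u < size w & wprod u = wprod w).
  by case=> u u_w eq_u; rewrite -eq_u; apply: IHn; rewrite ?eq_u // (leq_trans u_w).
move=> redw; case: w w_n fw1 redw => [|s w] /= w_n fw1 redw.
  by rewrite big_nil.
have red : reduced (s :: w).
  by move=> u eq_u; rewrite leqNgt; apply/negP => u_w; apply: redw; exists u.
case: (reduced_positive s (reduced_cons red)) => [|[u u_w eq_u]].
  have -> : wprod w = g s * wprod (s :: w) by rewrite big_cons gK.
  rewrite /positive fM fw1 mulmx1 alphaN mulNmx mxE oppr_gt0 => /lt_trans.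
  by move=> /(_ _ (phi_gt0 s)); rewrite ltxx.
case: redw; exists u; first exact: ltnW.
by rewrite big_cons eq_u gK.
Qed.

End SimplyLaced.

(** * Lifting representations to quotients *)

(** In a monoid of words [x * x^-1] differs from [1], so the compatibility with inverses must be
    required for [f] to respect the congruence. *)
Definition star_repr (K : fieldType) (d : nat) (M : starMonoidType)
    (f : M -> 'M[K]_d) : Prop :=
  [/\ f 1 = 1%:M%R, {morph f : x y / x * y >-> (x *m y)%R}
    & forall x, (f x *m f x^-1%g = 1%:M)%R].

Section Lift.
Variables (M : starMonoidType) (R : M -> M -> Prop).
Variables (K : fieldType) (d : nat) (f : M -> 'M[K]_d).
Hypothesis f_repr : star_repr f.
Hypothesis fR : forall u v, R u v -> f u = f v.

Definition gquot_lift (x : gquot R) : 'M[K]_d := f (generic_quotient.repr x).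

Lemma gquot_piM : {morph gquot_pi R : x y / x * y}.
Proof. by move=> x y; rewrite -gquot_mulE. Qed.

Lemma gquot_liftE u : gquot_lift (gquot_pi R u) = f u.
Proof.
have [f1 fM fV] := f_repr.
have /gquot_piP : gquot_pi R (generic_quotient.repr (gquot_pi R u)) = gquot_pi R u.
  exact: gquot_reprK.
rewrite /gquot_lift; move: (generic_quotient.repr _) => v; elim=> {u v} //.
- by move=> u; rewrite fM fV.
- by move=> u v w _ -> _ ->.
- by move=> u u' v v' _ eq_u _ eq_v; rewrite !fM eq_u eq_v.
Qed.

Lemma gquot_lift_repr : star_repr gquot_lift.
Proof.
have [f1 fM fV] := f_repr.
split=> [|x y|x]; first by rewrite [LHS]gquot_liftE.
  by rewrite -[x]gquot_reprK -[y]gquot_reprK -gquot_piM !gquot_liftE.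
by rewrite -[x]gquot_reprK [_^-1]gquot_invE !gquot_liftE.
Qed.

End Lift.

(** * Permutations and adjacent transpositions *)

Lemma conjg_commute (G : groupType) (x y : G) : commute x y -> x ^ y = x.
Proof. by move=> xy; apply/conjg_fixP/commgP. Qed.

Lemma ex_perm_map (T : finType) (u v : seq T) :
  uniq u -> uniq v -> size u = size v -> exists p : {perm T}, map p u = v.
Proof.
elim: u v => [|x u IHu] [|y v] //= => [_ _ _|]; first by exists 1.
move=> /andP[xNu u_uniq] /andP[yNv v_uniq] [] /(IHu _ u_uniq v_uniq)[p puv].
exists (p * tperm (p x) y); rewrite permM tpermL -puv; congr (_ :: _).
apply/eq_in_map => z zu; rewrite permM tpermD //.
  by apply: contra xNu => /eqP/perm_inj->.
by apply: contra yNv => /eqP->; rewrite -puv map_f.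
Qed.

Definition adj_tperm m k : 'S_m.+1 := tperm (inord k) (inord k.+1).

Lemma val_adj_tperm m k (a : 'I_m.+1) : k < m ->
  adj_tperm m k a =
    (if a == k :> nat then k.+1 else if a == k.+1 :> nat then k else a) :> nat.
Proof.
move=> k_m; rewrite /adj_tperm; have k_m1 := ltnW k_m.
case: tpermP => [->|->|/eqP + /eqP +]; rewrite ?inordK ?eqxx //.
  by case: eqP => //; lia.
by rewrite -!val_eqE /= !inordK // => /negPf-> /negPf->.
Qed.

(** A transposition of points at distance [c + 1] is a conjugate, by an adjacent one, of a
    transposition of points at distance [c]. *)
Lemma adj_tperm_gen m (P : 'S_m.+1 -> Prop) : P 1 ->
  (forall p q, P p -> P q -> P (p * q)) ->
  (forall k, k < m -> P (adj_tperm m k)) -> forall p, P p.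
Proof.
move=> P1 PM Padj.
have Pt c : forall a b : 'I_m.+1, b = a + c :> nat -> P (tperm a b).
  elim: c => [|c IHc] a b; first by rewrite addn0 => /val_inj->; rewrite tperm1.
  case: c IHc => [|c] IHc ab.
    suff -> : tperm a b = adj_tperm m a by apply: Padj; have := ltn_ord b; lia.
    rewrite /adj_tperm inord_val; congr tperm; apply: val_inj => /=.
    by have := ltn_ord b; rewrite ab addn1 => ?; rewrite inordK.
  have k_m : a + c.+1 < m by have := ltn_ord b; lia.
  pose q := adj_tperm m (a + c.+1).
  have -> : tperm a b = tperm a (inord (a + c.+1)) ^ q.
    rewrite tpermJ; congr tperm; apply: val_inj; rewrite /= val_adj_tperm //.
      by do !case: eqP => //; lia.
    by rewrite inordK ?eqxx 1?ltnW // -addnS.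
  rewrite conjgE [q^-1]tpermV; apply: (PM); first exact: Padj.
  by apply: (PM); [apply: IHc; rewrite inordK // ltnW | apply: Padj].
move=> p; have [ts -> _] := prod_tpermP p.
elim: ts => [|t ts IHts]; first by rewrite big_nil.
rewrite big_cons; apply: (PM) => //.
have [ab|/ltnW ab] := leqP t.1 t.2.
  by apply: (Pt (t.2 - t.1)); rewrite subnKC.
by rewrite tpermC; apply: (Pt (t.1 - t.2)); rewrite subnKC.
Qed.

(** * The reflections indexed by edges *)

Section Reflections.
Variables (G : groupType) (m : nat) (s r : nat -> G).

Hypothesis r2 : forall i, i < m -> r i * r i = 1.
Hypothesis r_far : forall i j, i < m -> j < m -> i.+1 < j -> commute (r i) (r j).
Hypothesis r_braid : forall i, i.+1 < m ->
  r i * r i.+1 * r i = r i.+1 * r i * r i.+1.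
Hypothesis s2 : forall i, i < m -> s i * s i = 1.
Hypothesis s_far : forall i j, i < m -> j < m -> i.+1 < j -> commute (s i) (s j).
Hypothesis s_braid : forall i, i.+1 < m ->
  s i * s i.+1 * s i = s i.+1 * s i * s i.+1.
Hypothesis sr : forall i, i < m -> commute (s i) (r i).
Hypothesis sr_far : forall i j, i < m -> j < m -> (i.+1 < j) || (j.+1 < i) ->
  commute (s i) (r j).
Hypothesis sr_mixed : forall i, i.+1 < m ->
  r i * r i.+1 * s i = s i.+1 * r i * r i.+1.

(* [above a k] is the reflection attached to the edge {a, a + k + 1}. *)
Fixpoint above (a k : nat) : G :=
  if k is k'.+1 then above a k' ^ r (a + k) else s a.

Let rV i : i < m -> (r i)^-1 = r i.
Proof. by move=> im; apply: mulg1_eq; apply: r2. Qed.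

Lemma conj_rr i x : i < m -> (x ^ r i) ^ r i = x.
Proof. by move=> im; rewrite -conjgM r2 // conjg1. Qed.

(** The mixed relation, read as two ways to reach the edge [{i, i+2}]. *)
Lemma conj_mixed i : i.+1 < m -> s i.+1 ^ r i = s i ^ r i.+1.
Proof.
move=> im; have im' := ltnW im; rewrite !conjgE !rV //.
have /(congr1 (fun x => r i * (x * r i.+1))) := sr_mixed im.
by rewrite -!mulgA r2 // mulg1 [LHS]mulgA r2 // mul1g.
Qed.

Lemma above_far a k i : i < m -> a + k < m -> (i.+1 < a) || (a + k.+1 < i) ->
  above a k ^ r i = above a k.
Proof.
move=> im; elim: k => [|k IHk] akm far /=.
  by apply: conjg_commute; apply: sr_far => //; lia.
have rC : commute (r i) (r (a + k.+1)).
  case/orP: far => far; first by apply: r_far => //; lia.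
  by apply: commute_sym; apply: r_far => //; lia.
by rewrite -conjgM -rC conjgM IHk //; lia.
Qed.

Lemma above_left a k : a.+1 + k < m -> above a.+1 k ^ r a = above a k.+1.
Proof.
elim: k => [|k IHk] akm /=; first by rewrite addn1 conj_mixed //; lia.
have rC : commute (r (a.+1 + k.+1)) (r a).
  by apply: commute_sym; apply: r_far; lia.
by rewrite -conjgM rC conjgM IHk ?addSnnS //; lia.
Qed.

Lemma above_inside a k i : a < i -> i < a + k -> a + k < m ->
  above a k ^ r i = above a k.
Proof.
elim: k => [|k IHk] ai ik km; first by lia.
have [i_lt | i_ge] := ltnP i (a + k).
  have rC : commute (r (a + k.+1)) (r i).
    by apply: commute_sym; apply: r_far; lia.
  by rewrite /= -conjgM rC conjgM IHk //; lia.
case: k {IHk} => [|k] in ik i_ge km *; first by lia.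
have -> : i = (a + k).+1 by lia.
(* The braid relation moves [r i.+1] to the front, where it fixes the shorter edge. *)
rewrite /= !addnS -!conjgM mulgA r_braid; last by lia.
by rewrite -mulgA [LHS]conjgM above_far; [| lia..].
Qed.

(** The offset is the distance minus one, since [above a 0] is the edge [{a, a+1}]. On the diagonal
    the junk value is [s a]. *)
Definition refl_nat (a b : nat) : G :=
  if a < b then above a (b - a.+1) else above b (a - b.+1).

Lemma refl_natC a b : refl_nat a b = refl_nat b a.
Proof. by rewrite /refl_nat; case: ltngtP => // ->. Qed.

(** With [a < b], the cases follow the position of [i] and [i + 1] relative to [a] and [b]; moving
    an end inwards undoes the conjugation that moved it outwards. *)
Lemma refl_nat_conj i a b : i < m -> a <= m -> b <= m -> a != b ->
  refl_nat a b ^ r i =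
  refl_nat (if a == i then i.+1 else if a == i.+1 then i else a)
           (if b == i then i.+1 else if b == i.+1 then i else b).
Proof.
move=> im; wlog ab : a b / a < b.
  move=> IH am bm aNb; have [ab|ba|/eqP] := ltngtP a b; last by rewrite (negPf aNb).
    exact: IH.
  by rewrite refl_natC IH 1?eq_sym // refl_natC.
move=> _ bm _; have [k eq_b] : exists k, b = a + k.+1.
  by exists (b - a.+1); lia.
have aboveE c l : refl_nat c (c + l.+1) = above c l.
  by rewrite /refl_nat ifT; [congr above | ]; lia.
have refl_eq c c' e e' : c = c' -> e = e' -> refl_nat c e = refl_nat c' e'.
  by move=> -> ->.
rewrite {}eq_b in ab bm *; rewrite aboveE.
have [ia | ia] := boolP (i.+1 < a).
  rewrite above_far ?ia //; last by lia.
  by rewrite -aboveE; apply: refl_eq; do ?case: eqP; lia.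
have [ib | ib] := boolP (a + k.+1 < i).
  rewrite above_far ?ib ?orbT //; last by lia.
  by rewrite -aboveE; apply: refl_eq; do ?case: eqP; lia.
have [ia1 | ia1] := eqVneq i.+1 a.
  rewrite -ia1 above_left; last by lia.
  by rewrite -aboveE; apply: refl_eq; do ?case: eqP; lia.
have [eq_ib | ib1] := eqVneq i (a + k.+1).
  rewrite {}eq_ib -[_ ^ _]/(above a k.+1).
  by rewrite -aboveE; apply: refl_eq; do ?case: eqP; lia.
case: k => [|k] in ab bm ib ib1 *.
  (* The edge is [{i, i+1}] itself, and this is where the Gauss relation enters. *)
  have -> : i = a by lia.
  rewrite conjg_commute; last by apply: sr; lia.
  by rewrite refl_natC -aboveE; apply: refl_eq; do ?case: eqP; lia.
have [eq_ia | iNa] := eqVneq i a.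
  rewrite {}eq_ia -above_left; last by lia.
  rewrite conj_rr; last by lia.
  by rewrite -aboveE; apply: refl_eq; do ?case: eqP; lia.
have [eq_ib | ib2] := eqVneq i (a + k.+1).
  rewrite eq_ib /= conj_rr; last by lia.
  by rewrite -aboveE; apply: refl_eq; do ?case: eqP; lia.
rewrite above_inside; [|lia..].
by rewrite -aboveE; apply: refl_eq; do ?case: eqP; lia.
Qed.

Lemma refl_adj i : i < m ->
  refl_nat (inord i : 'I_m.+1) (inord i.+1 : 'I_m.+1) = s i.
Proof.
by move=> im; rewrite !inordK //; [rewrite /refl_nat ltnSn subnn | lia].
Qed.

Lemma refl_conj_adj i (a b : 'I_m.+1) : i < m -> a != b ->
  refl_nat a b ^ r i = refl_nat (adj_tperm m i a) (adj_tperm m i b).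
Proof.
by move=> im aNb; rewrite refl_nat_conj ?val_adj_tperm // -ltnS ltn_ord.
Qed.

Lemma refl_conj (p : 'S_m.+1) :
  exists x : G, forall a b : 'I_m.+1, a != b -> refl_nat a b ^ x = refl_nat (p a) (p b).
Proof.
elim/adj_tperm_gen: p => [|p q [x xP] [y yP]|k km].
- by exists 1 => a b _; rewrite conjg1 !perm1.
- exists (x * y) => a b aNb.
  by rewrite conjgM xP // yP ?(inj_eq perm_inj) // !permM.
by exists (r k) => a b; apply: refl_conj_adj.
Qed.

(** Symmetry reduction: a relation between edges on distinct vertices need only be checked on the
    vertices [0, 1, ...], where it is a relation between the [s i]. *)
Lemma refl_move (u : seq 'I_m.+1) : uniq u ->
  exists x : G, forall i j, i < size u -> j < size u -> i != j ->
    refl_nat i j ^ x = refl_nat (nth ord0 u i) (nth ord0 u j).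
Proof.
move=> u_uniq; have u_le : size u <= m.+1.
  by rewrite -(card_uniqP u_uniq) (leq_trans (max_card _)) ?card_ord.
pose v := map (@inord m) (iota 0 (size u)).
have v_uniq : uniq v.
  rewrite map_inj_in_uniq ?iota_uniq // => i j; rewrite !mem_iota /= => i_lt j_lt.
  by move=> /(congr1 val); rewrite /= !inordK // (leq_trans _ u_le).
have [|p pvu] := ex_perm_map v_uniq u_uniq; first by rewrite size_map size_iota.
have [x xP] := refl_conj p; exists x => i j i_lt j_lt iNj.
have nthE k : k < size u -> nth ord0 u k = p (inord k).
  move=> k_lt; rewrite -pvu (nth_map ord0) ?size_map ?size_iota //.
  by rewrite (nth_map 0) ?size_iota // nth_iota.
have inordE k : k < size u -> @inord m k = k :> nat.
  by move=> k_lt; rewrite inordK // (leq_trans k_lt u_le).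
rewrite !nthE // -xP; first by rewrite !inordE.
by rewrite -val_eqE /= !inordE.
Qed.

Lemma refl_invol (a b : 'I_m.+1) : a != b -> refl_nat a b * refl_nat a b = 1.
Proof.
move=> aNb; have ab_uniq : uniq [:: a; b] by rewrite /= inE aNb.
(* Two distinct vertices force [m >= 1], so that [s 0] is in range. *)
have m1 := uniq_leq_size ab_uniq (fun x _ => mem_enum 'I_m.+1 x).
rewrite size_enum_ord /= in m1.
have [x xP] := refl_move ab_uniq.
rewrite -[refl_nat a b](xP 0 1%N) // -conjMg s2 ?conj1g //; lia.
Qed.

Lemma refl_braid (a b c : 'I_m.+1) : uniq [:: a; b; c] ->
  refl_nat a b * refl_nat b c * refl_nat a b = refl_nat b c * refl_nat a b * refl_nat b c.
Proof.
move=> abc_uniq.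
have m2 := uniq_leq_size abc_uniq (fun x _ => mem_enum 'I_m.+1 x).
rewrite size_enum_ord /= in m2.
have [x xP] := refl_move abc_uniq.
rewrite -[refl_nat a b](xP 0 1%N) // -[refl_nat b c](xP 1%N 2) // -!conjMg.
by rewrite -[refl_nat 0 1%N]/(s 0) -[refl_nat 1%N 2]/(s 1%N) s_braid.
Qed.

Lemma refl_comm (a b c d : 'I_m.+1) : uniq [:: a; b; c; d] ->
  refl_nat a b * refl_nat c d = refl_nat c d * refl_nat a b.
Proof.
move=> abcd_uniq.
have m3 := uniq_leq_size abcd_uniq (fun x _ => mem_enum 'I_m.+1 x).
rewrite size_enum_ord /= in m3.
have [x xP] := refl_move abcd_uniq.
rewrite -[refl_nat a b](xP 0 1%N) // -[refl_nat c d](xP 2 3) // -!conjMg.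
by rewrite -[refl_nat 0 1%N]/(s 0) -[refl_nat 2 3]/(s 2) s_far //; lia.
Qed.

End Reflections.

(** * The matrices *)

Section Matrices.
Variable n : nat.
Local Notation E := {set 'I_n}.
Local Notation N := #|{: {set 'I_n}}|.

Definition basis_vec (h : E) : 'rV[rat]_N := delta_mx 0%R (enum_rank h).

Definition mx_of (F : E -> 'rV[rat]_N) : 'M[rat]_N :=
  (\matrix_i F (enum_val i))%R.

Lemma mul_mx_of F h : (basis_vec h *m mx_of F = F h)%R.
Proof. by rewrite -rowE rowK enum_rankK. Qed.

Lemma eq_on_basis (A B : 'M[rat]_N) :
  (forall h, basis_vec h *m A = basis_vec h *m B)%R -> A = B.
Proof.
move=> AB; apply/row_matrixP => i; rewrite !rowE.
by have := AB (enum_val i); rewrite /basis_vec enum_valK.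
Qed.

(* Twice the Tits form on the 2-subsets.  The other subsets carry the trivial *)
(* action of the reflections: the singletons are kept so that a permutation   *)
(* can be read off its action.                                                *)
Definition cartan (e h : E) : rat :=
  if #|h| == 2 then
    (if #|e :&: h| == 2 then 2 else if #|e :&: h| == 1%N then -1 else 0)%R
  else 0%R.

Definition refl_mx (e : E) : 'M[rat]_N :=
  mx_of (fun h => basis_vec h - cartan e h *: basis_vec e)%R.

Definition perm_set_mx (p : 'S_n) : 'M[rat]_N :=
  mx_of (fun h => basis_vec (p @: h)).

Lemma mul_refl_mx e h :
  (basis_vec h *m refl_mx e = basis_vec h - cartan e h *: basis_vec e)%R.
Proof. exact: mul_mx_of. Qed.

Lemma mul_perm_set_mx p h :
  (basis_vec h *m perm_set_mx p)%R = basis_vec (p @: h).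
Proof. exact: mul_mx_of. Qed.

Lemma perm_set_mx1 : perm_set_mx 1 = 1%:M%R.
Proof.
apply: eq_on_basis => h; rewrite mul_perm_set_mx mulmx1; congr basis_vec.
by rewrite -[RHS]imset_id; apply: eq_imset => x; rewrite perm1.
Qed.

Lemma perm_set_mxM p q : perm_set_mx (p * q) = (perm_set_mx p *m perm_set_mx q)%R.
Proof.
apply: eq_on_basis => h; rewrite mulmxA !mul_perm_set_mx -imset_comp.
by congr basis_vec; apply: eq_imset => x; rewrite /= permM.
Qed.

Lemma basis_vec_inj : injective basis_vec.
Proof.
move=> e h /(congr1 (fun v : 'rV_N => v 0%R (enum_rank h))).
rewrite !mxE !eqxx /= (inj_eq enum_rank_inj).
by case: (h =P e) => // _ /eqP; rewrite eq_sym oner_eq0.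
Qed.

Lemma perm_set_mx_faithful p :
  (forall a, basis_vec [set a] *m perm_set_mx p = basis_vec [set a])%R -> p = 1.
Proof.
move=> p1; apply/permP => a; have := p1 a.
by rewrite mul_perm_set_mx imset_set1 perm1 => /basis_vec_inj/set1_inj.
Qed.

Lemma mul_basis_col (F : E -> rat) h :
  ((basis_vec h *m (\col_i F (enum_val i))) 0 0 = F h)%R.
Proof. by rewrite -rowE !mxE enum_rankK. Qed.

Lemma cartan_perm (p : 'S_n) (e h : E) : cartan (p @: e) (p @: h) = cartan e h.
Proof.
rewrite /cartan -imsetI; last by move=> x y _ _; apply: perm_inj.
by rewrite !(card_imset _ perm_inj).
Qed.

(** Permutations preserve the form [cartan], hence conjugate reflections to reflections. *)
Lemma refl_perm_mx (e : E) (p : 'S_n) :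
  (refl_mx e *m perm_set_mx p = perm_set_mx p *m refl_mx (p @: e))%R.
Proof.
apply: eq_on_basis => h; rewrite !mulmxA mul_refl_mx mulmxBl -scalemxAl.
by rewrite !mul_perm_set_mx mul_refl_mx cartan_perm.
Qed.

Lemma refl_mx_fix (e : E) (p : 'S_n) : p @: e = e ->
  (refl_mx e *m perm_set_mx p = perm_set_mx p *m refl_mx e)%R.
Proof. by move=> pe; rewrite refl_perm_mx pe. Qed.

Lemma refl_mx2 (e : E) : #|e| = 2 -> (refl_mx e *m refl_mx e = 1%:M)%R.
Proof.
move=> e2; have cee : cartan e e = 2%R by rewrite /cartan setIid e2.
apply: eq_on_basis => h; rewrite mulmxA mulmx1 !(mul_refl_mx, mulmxBl, =^~ scalemxAl).
by rewrite cee; apply/rowP => k; rewrite !mxE; ring.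
Qed.

Lemma refl_mx_comm e f : cartan e f = 0%R -> cartan f e = 0%R ->
  (refl_mx e *m refl_mx f = refl_mx f *m refl_mx e)%R.
Proof.
move=> ef fe; apply: eq_on_basis => h.
rewrite !mulmxA !(mul_refl_mx, mulmxBl, =^~ scalemxAl) ef fe.
by apply/rowP => k; rewrite !mxE; ring.
Qed.

Lemma refl_mx_braid (e f : E) : #|e| = 2 -> #|f| = 2 ->
    cartan e f = (-1)%R -> cartan f e = (-1)%R ->
  (refl_mx e *m refl_mx f *m refl_mx e = refl_mx f *m refl_mx e *m refl_mx f)%R.
Proof.
move=> e2 f2 ef fe; have cc (x : E) : #|x| = 2 -> cartan x x = 2%R.
  by move=> x2; rewrite /cartan setIid x2.
apply: eq_on_basis => h.
rewrite !mulmxA !(mul_refl_mx, mulmxBl, =^~ scalemxAl, mulmxDl, mulNmx).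
by rewrite ef fe !cc //; apply/rowP => k; rewrite !mxE; ring.
Qed.

End Matrices.

(** * The matrices of the generators and the relations of [VB] *)

Section GaussRepr.
Variable m : nat.
Local Notation N := #|{: {set 'I_m.+1}}|.

Definition adj_edge (k : nat) : {set 'I_m.+1} := [set inord k; inord k.+1].

Lemma inord_eq i j : i <= m -> j <= m -> (inord i == inord j :> 'I_m.+1) = (i == j).
Proof. by move=> i_m j_m; rewrite -val_eqE /= !inordK. Qed.

Lemma card_adj_edge k : k < m -> #|adj_edge k| = 2.
Proof. by move=> k_m; rewrite cards2 inord_eq ?(ltnW k_m) // ltn_eqF. Qed.

Lemma cartan_far (e h : {set 'I_m.+1}) : [disjoint e & h] -> cartan e h = 0%R.
Proof. by rewrite -setI_eq0 /cartan => /eqP->; rewrite cards0; case: ifP. Qed.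

Lemma cartan_near (a b c : 'I_m.+1) : uniq [:: a; b; c] ->
  cartan [set a; b] [set b; c] = (-1)%R.
Proof.
rewrite /= !inE !negb_or /cartan => /and3P[/andP[ab ac] bc _].
suff -> : [set a; b] :&: [set b; c] = [set b].
  by rewrite cards2 bc cards1.
apply/setP => x; rewrite !inE; case: (eqVneq x a) => [->|] /=.
  by rewrite (negPf ab) (negPf ac).
by case: (x == b).
Qed.

Definition gen_mx (x : VB_gen m.+1) : 'M[rat]_N :=
  match x with
  | inl i => refl_mx (adj_edge i)
  | inr i => perm_set_mx (adj_tperm m i)
  end.

(** Signs of letters are dropped because every generator acts by an involution. *)
Definition word_mx (w : word (VB_gen m.+1)) : 'M[rat]_N :=
  foldr (fun l A => gen_mx l.1 *m A)%R 1%:M%R w.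

Lemma gen_mx2 x : (gen_mx x *m gen_mx x = 1%:M)%R.
Proof.
case: x => i /=; first by rewrite refl_mx2 // card_adj_edge.
by rewrite -perm_set_mxM tperm2 perm_set_mx1.
Qed.

Lemma word_mxM : {morph word_mx : u v / u * v >-> (u *m v)%R}.
Proof.
move=> u v; rewrite -[u * v]/(u ++ v).
by elim: u => [|l u /= ->]; rewrite ?mul1mx // mulmxA.
Qed.

Lemma word_mx_letter x : word_mx (letter x) = gen_mx x.
Proof. by rewrite /= mulmx1. Qed.

Lemma word_mx_repr : star_repr word_mx.
Proof.
split=> // [|w]; first exact: word_mxM.
rewrite -[w^-1]/(word_inv w).
elim: w => [|l w IHw]; first by rewrite mulmx1.
rewrite /word_inv /= rev_cons -cats1 [word_mx (_ ++ _)]word_mxM /= mulmx1.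
by rewrite -mulmxA (mulmxA (word_mx w)) IHw mul1mx gen_mx2.
Qed.

Lemma adj_tperm_fix i k : i < m -> k < m -> (i.+1 < k) || (k.+1 < i) ->
  adj_tperm m k @: adj_edge i = adj_edge i.
Proof.
move=> i_m k_m far; rewrite /adj_edge imsetU1 imset_set1.
by rewrite !tpermD // inord_eq //; lia.
Qed.

Lemma adj_tperm_swap i : i < m -> adj_tperm m i @: adj_edge i = adj_edge i.
Proof.
by move=> i_m; rewrite /adj_edge imsetU1 imset_set1 tpermL tpermR setUC.
Qed.

Lemma adj_tperm_braid i : i.+1 < m ->
  adj_tperm m i * adj_tperm m i.+1 * adj_tperm m i =
  adj_tperm m i.+1 * adj_tperm m i * adj_tperm m i.+1.
Proof.
have conjE (a b c d : 'I_m.+1) :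
    tperm a b * tperm c d * tperm a b = tperm c d ^ tperm a b.
  by rewrite conjgE tpermV mulgA.
move=> i_m; rewrite !conjE !tpermJ tpermR tpermL.
by rewrite !tpermD // inord_eq //; lia.
Qed.

Lemma adj_tperm_comm i j : i < m -> j < m -> (i.+1 < j) || (j.+1 < i) ->
  adj_tperm m i * adj_tperm m j = adj_tperm m j * adj_tperm m i.
Proof.
move=> i_m j_m far; rewrite conjgC; congr (_ * _).
by rewrite tpermJ !tpermD // inord_eq //; lia.
Qed.

Lemma adj_edge_disjoint i j : i < m -> j < m -> (i.+1 < j) || (j.+1 < i) ->
  [disjoint adj_edge i & adj_edge j].
Proof.
move=> i_m j_m far; apply/pred0P => x; apply/negP; rewrite /= !inE.
by case/andP => /orP[]/eqP->; rewrite !inord_eq //; lia.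
Qed.

Lemma adj_edge_cartan i : i.+1 < m ->
  cartan (adj_edge i) (adj_edge i.+1) = (-1)%R /\
  cartan (adj_edge i.+1) (adj_edge i) = (-1)%R.
Proof.
move=> i_m; split; last rewrite /adj_edge setUC [X in cartan _ X]setUC.
  by apply: cartan_near; rewrite /= !inE !inord_eq //; lia.
by apply: cartan_near; rewrite /= !inE !inord_eq //; lia.
Qed.

Lemma word_mx_VB u v : @VB_rel m.+1 u v -> word_mx u = word_mx v.
Proof.
case=> {u v} => [i j ij|i j far|i j ij|i j far|i|i j far|i j ij];
  rewrite ?expg2 !word_mxM !word_mx_letter /=.
- have i_m : i.+1 < m by rewrite -ij; apply: (ltn_ord j).
  have [c1 c2] := adj_edge_cartan i_m.
  by rewrite ij refl_mx_braid // card_adj_edge // ltnW.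
- have dis := adj_edge_disjoint (ltn_ord i) (ltn_ord j) far.
  by apply: refl_mx_comm; apply: cartan_far; rewrite // disjoint_sym.
- have i_m : i.+1 < m by rewrite -ij; apply: (ltn_ord j).
  by rewrite -!perm_set_mxM ij adj_tperm_braid.
- by rewrite -!perm_set_mxM adj_tperm_comm //; apply: ltn_ord.
- exact: (gen_mx2 (inr i)).
- apply: refl_mx_fix; apply: adj_tperm_fix; [exact: ltn_ord.. | by []].
have i_m : i.+1 < m by rewrite -ij; apply: (ltn_ord j).
(* It remains to see that the permutation carries the edge [{i+1, i+2}] to [{i, i+1}]. *)
rewrite -[RHS]mulmxA -!perm_set_mxM refl_perm_mx; congr (_ *m refl_mx _)%R.
have t_i : adj_tperm m i.+1 (inord i) = inord i.
  by rewrite tpermD // inord_eq //; lia.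
have t_i2 : adj_tperm m i (inord i.+2) = inord i.+2.
  by rewrite tpermD // inord_eq //; lia.
by rewrite ij /adj_edge imsetU1 imset_set1 !permM t_i2 !tpermR t_i.
Qed.

End GaussRepr.

(** * The virtual Gauss braid group *)

Section GaussGroup.
Variable m : nat.
Local Notation G := (GVB m.+1).

Definition GVB_pi (w : word (VB_gen m.+1)) : G :=
  gquot_pi (@GVB_rel m.+1) (gquot_pi (@FVB_rel m.+1) (gquot_pi (@VB_rel m.+1) w)).

Lemma GVB_piM : {morph GVB_pi : u v / u * v}.
Proof. by move=> u v; rewrite /GVB_pi !gquot_piM. Qed.

Lemma GVB_pi_rel u v : @VB_rel m.+1 u v -> GVB_pi u = GVB_pi v.
Proof.
by move=> uv; congr (gquot_pi _ (gquot_pi _ _)); apply/gquot_piP/congr_rel.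
Qed.

(* Out of range indices k >= m get the junk value 1. *)
Definition GVB_s (k : nat) : G :=
  if insub k is Some i then GVB_pi (@sigma_ m.+1 i) else 1.
Definition GVB_r (k : nat) : G :=
  if insub k is Some i then GVB_pi (@rho_ m.+1 i) else 1.

Lemma GVB_sE (i : 'I_m) : GVB_s i = GVB_pi (@sigma_ m.+1 i).
Proof. by rewrite /GVB_s valK. Qed.
Lemma GVB_rE (i : 'I_m) : GVB_r i = GVB_pi (@rho_ m.+1 i).
Proof. by rewrite /GVB_r valK. Qed.

Lemma GVB_r2 i : i < m -> GVB_r i * GVB_r i = 1.
Proof.
move=> im; rewrite (GVB_rE (Ordinal im)) -GVB_piM -expg2.
exact: (GVB_pi_rel (VB_R5 _)).
Qed.

Lemma GVB_r_far i j : i < m -> j < m -> i.+1 < j -> commute (GVB_r i) (GVB_r j).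
Proof.
move=> im jm ij; rewrite /commute (GVB_rE (Ordinal im)) (GVB_rE (Ordinal jm)).
by rewrite -!GVB_piM; apply/GVB_pi_rel/VB_R4; rewrite /far /= ij.
Qed.

Lemma GVB_r_braid i : i.+1 < m ->
  GVB_r i * GVB_r i.+1 * GVB_r i = GVB_r i.+1 * GVB_r i * GVB_r i.+1.
Proof.
move=> im; rewrite (GVB_rE (Ordinal (ltnW im))) (GVB_rE (Ordinal im)).
by rewrite -!GVB_piM; apply/GVB_pi_rel/VB_R3.
Qed.

Lemma GVB_s2 i : i < m -> GVB_s i * GVB_s i = 1.
Proof.
move=> im; rewrite (GVB_sE (Ordinal im)) /GVB_pi -!gquot_piM -expg2.
congr (gquot_pi _ _); apply/gquot_piP/congr_rel; rewrite gquot_piM -expg2.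
exact: FVB_sigma2.
Qed.

Lemma GVB_s_far i j : i < m -> j < m -> i.+1 < j -> commute (GVB_s i) (GVB_s j).
Proof.
move=> im jm ij; rewrite /commute (GVB_sE (Ordinal im)) (GVB_sE (Ordinal jm)).
by rewrite -!GVB_piM; apply/GVB_pi_rel/VB_R2; rewrite /far /= ij.
Qed.

Lemma GVB_s_braid i : i.+1 < m ->
  GVB_s i * GVB_s i.+1 * GVB_s i = GVB_s i.+1 * GVB_s i * GVB_s i.+1.
Proof.
move=> im; rewrite (GVB_sE (Ordinal (ltnW im))) (GVB_sE (Ordinal im)).
by rewrite -!GVB_piM; apply/GVB_pi_rel/VB_R1.
Qed.

Lemma GVB_sr i : i < m -> commute (GVB_s i) (GVB_r i).
Proof.
move=> im; rewrite /commute (GVB_sE (Ordinal im)) (GVB_rE (Ordinal im)).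
rewrite /GVB_pi -[LHS]gquot_piM -[RHS]gquot_piM.
apply/gquot_piP/congr_rel; exact: GVB_comm.
Qed.

Lemma GVB_sr_far i j : i < m -> j < m -> (i.+1 < j) || (j.+1 < i) ->
  commute (GVB_s i) (GVB_r j).
Proof.
move=> im jm ij; rewrite /commute (GVB_sE (Ordinal im)) (GVB_rE (Ordinal jm)).
by rewrite -!GVB_piM; apply/GVB_pi_rel/VB_R6.
Qed.

Lemma GVB_sr_mixed i : i.+1 < m ->
  GVB_r i * GVB_r i.+1 * GVB_s i = GVB_s i.+1 * GVB_r i * GVB_r i.+1.
Proof.
move=> im; rewrite (GVB_sE (Ordinal (ltnW im))) (GVB_sE (Ordinal im)).
rewrite (GVB_rE (Ordinal (ltnW im))) (GVB_rE (Ordinal im)).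
by rewrite -!GVB_piM; apply/GVB_pi_rel/VB_M.
Qed.

(** Inverse letters give no separate case, since all generators are involutions. *)
Lemma GVB_ind (P : G -> Prop) : P 1 ->
  (forall (i : 'I_m) x, P x -> P (GVB_s i * x)) ->
  (forall (i : 'I_m) x, P x -> P (GVB_r i * x)) -> forall x, P x.
Proof.
move=> P1 Ps Pr x.
have [w ->] : exists w, x = GVB_pi w.
  exists (generic_quotient.repr (generic_quotient.repr (generic_quotient.repr x))).
  by rewrite /GVB_pi !gquot_reprK.
have pi1 : GVB_pi 1 = 1 by [].
have piV u : GVB_pi u^-1 = (GVB_pi u)^-1.
  apply/esym/mulg1_eq; rewrite -GVB_piM -pi1.
  by congr (gquot_pi _ (gquot_pi _ _)); apply/gquot_piP/congr_mulV.
have invol (y : G) : y * y = 1 -> y^-1 = y by apply: mulg1_eq.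
elim: w => [|[y b] w IHw]; first exact: P1.
have letterE (z : VB_gen m.+1) : GVB_pi [:: (z, b)] =
    if b then GVB_pi (letter z) else (GVB_pi (letter z))^-1.
  by case: b; rewrite // -piV.
rewrite -[(y, b) :: w]/(([:: (y, b)] : word _) * (w : word _)) GVB_piM letterE.
case: y => i; [move: (Ps i)|move: (Pr i)] => Pi; move: (Pi _ IHw).
  rewrite GVB_sE => ?; case: b {letterE} => //.
  by rewrite invol // -GVB_sE GVB_s2.
rewrite GVB_rE => ?; case: b {letterE} => //.
by rewrite invol // -GVB_rE GVB_r2.
Qed.

(** * The representation of [GVB] and the relations between edge reflections *)

Definition FVB_mx := gquot_lift (R := @FVB_rel m.+1)
  (gquot_lift (R := @VB_rel m.+1) (@word_mx m)).
Definition GVB_mx := gquot_lift (R := @GVB_rel m.+1) FVB_mx.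

Let VB_repr := gquot_lift_repr (@word_mx_repr m) (@word_mx_VB m).

Lemma FVB_mx_rel u v : @FVB_rel m.+1 u v ->
  gquot_lift (R := @VB_rel m.+1) (@word_mx m) u =
  gquot_lift (R := @VB_rel m.+1) (@word_mx m) v.
Proof.
case=> i; have [f1 fM _] := VB_repr; rewrite expg2 f1 fM.
rewrite (gquot_liftE (@word_mx_repr m) (@word_mx_VB m)) word_mx_letter.
exact: gen_mx2.
Qed.

Let FVB_repr := gquot_lift_repr VB_repr FVB_mx_rel.

Lemma GVB_mx_rel u v : @GVB_rel m.+1 u v -> FVB_mx u = FVB_mx v.
Proof.
case=> i; have [_ fM _] := FVB_repr; rewrite /FVB_mx !fM.
rewrite !(gquot_liftE VB_repr FVB_mx_rel).
rewrite !(gquot_liftE (@word_mx_repr m) (@word_mx_VB m)) !word_mx_letter.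
by apply: refl_mx_fix; apply: adj_tperm_swap.
Qed.

Lemma GVB_mx_pi w : GVB_mx (GVB_pi w) = word_mx w.
Proof.
rewrite /GVB_mx /FVB_mx (gquot_liftE FVB_repr GVB_mx_rel) (gquot_liftE VB_repr FVB_mx_rel).
exact: (gquot_liftE (@word_mx_repr m) (@word_mx_VB m)).
Qed.

Lemma GVB_mx_repr : linear_repr GVB_mx.
Proof. by case: (gquot_lift_repr FVB_repr GVB_mx_rel). Qed.

Lemma GVB_mx1 : GVB_mx 1 = 1%:M%R. Proof. by case: GVB_mx_repr. Qed.
Lemma GVB_mxM x y : GVB_mx (x * y) = (GVB_mx x *m GVB_mx y)%R.
Proof. by case: GVB_mx_repr => _ ->. Qed.

Lemma GVB_mx_s k : k < m -> GVB_mx (GVB_s k) = refl_mx (adj_edge m k).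
Proof. by move=> km; rewrite (GVB_sE (Ordinal km)) GVB_mx_pi word_mx_letter. Qed.
Lemma GVB_mx_r k : k < m -> GVB_mx (GVB_r k) = perm_set_mx (adj_tperm m k).
Proof. by move=> km; rewrite (GVB_rE (Ordinal km)) GVB_mx_pi word_mx_letter. Qed.

Definition GVB_refl (a b : nat) : G := refl_nat GVB_s GVB_r a b.

Lemma GVB_mx_above a k : a + k < m ->
  GVB_mx (above GVB_s GVB_r a k) = refl_mx [set inord a; inord (a + k.+1)].
Proof.
elim: k => [|k IHk] akm; first by rewrite addn0 in akm; rewrite addn1 GVB_mx_s.
rewrite /= conjgE (mulg1_eq (GVB_r2 akm)) !GVB_mxM GVB_mx_r // IHk; last by lia.
rewrite refl_perm_mx mulmxA -perm_set_mxM tperm2 perm_set_mx1 mul1mx.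
congr refl_mx; rewrite imsetU1 imset_set1 tpermL -addnS.
by rewrite tpermD // inord_eq //; lia.
Qed.

Lemma GVB_mx_refl (a b : 'I_m.+1) : a != b ->
  GVB_mx (GVB_refl a b) = refl_mx [set a; b].
Proof.
wlog ab : a b / a < b.
  move=> IH aNb; have [ab|ba|/val_inj] := ltngtP a b; first exact: IH.
    by rewrite /GVB_refl refl_natC setUC IH // eq_sym.
  by move/eqP; rewrite (negPf aNb).
move=> _; rewrite /GVB_refl /refl_nat ab GVB_mx_above.
  have -> : a + (b - a.+1).+1 = b by lia.
  by rewrite !inord_val.
by have := ltn_ord b; lia.
Qed.

(** If the edges meet, reversing them reduces to [near], which also covers equal edges; disjoint
    edges commute. *)
Lemma GVB_coxeter_refl (a b c d : 'I_m.+1) : a != b -> c != d ->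
  coxeter_pair GVB_mx (GVB_refl a b) (GVB_refl c d)
    (basis_vec [set a; b]) (basis_vec [set c; d]).
Proof.
have near (x y z : 'I_m.+1) : x != y -> y != z ->
    coxeter_pair GVB_mx (GVB_refl x y) (GVB_refl y z)
      (basis_vec [set x; y]) (basis_vec [set y; z]).
  move=> xy yz; have [<-|xz] := eqVneq x z; first by apply: CoxeterEq; apply: refl_natC.
  have xyz : uniq [:: x; y; z] by rewrite /= !inE negb_or xy xz yz.
  apply: CoxeterBraid; rewrite ?GVB_mx_refl // ?mul_refl_mx.
  - rewrite [X in cartan X]setUC [X in cartan _ X]setUC cartan_near.
      by rewrite scaleN1r opprK.
    by rewrite /= !inE negb_or !(eq_sym z) (eq_sym y x) xy xz yz.
  - by rewrite cartan_near // scaleN1r opprK addrC.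
  - apply: (@refl_braid _ m) => //; [exact: GVB_r2 | exact: GVB_r_far
    | exact: GVB_r_braid | exact: GVB_s_braid | exact: GVB_sr | exact: GVB_sr_far
    | exact: GVB_sr_mixed].
move=> ab cd.
have reflC x y : GVB_refl x y = GVB_refl y x by apply: refl_natC.
have [bc|bc] := eqVneq b c; first by rewrite -bc in cd *; apply: near.
have [ac|ac] := eqVneq a c.
  by rewrite -ac in cd *; rewrite reflC [[set a; b]]setUC; apply: near; rewrite // eq_sym.
have [bd|bd] := eqVneq b d.
  rewrite -bd in cd *; rewrite [GVB_refl c b]reflC [[set c; b]]setUC.
  by apply: near; rewrite // eq_sym.
have [ad|ad] := eqVneq a d.
  rewrite -ad in cd *; rewrite [GVB_refl c a]reflC [[set c; a]]setUC.
  rewrite reflC [[set a; b]]setUC.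
  by apply: near; rewrite // eq_sym.
apply: CoxeterComm.
  rewrite GVB_mx_refl // mul_refl_mx cartan_far ?scale0r ?subr0 //.
  rewrite disjoint_sym; apply/pred0P => x; apply/negP; rewrite /= !inE.
  by case/andP => /orP[]/eqP->; rewrite ?(negPf ac, negPf ad, negPf bc, negPf bd).
have abcd : uniq [:: a; b; c; d].
  by rewrite /= !inE !negb_or ab ac ad bc bd cd.
apply: (@refl_comm _ m) => //; [exact: GVB_r2 | exact: GVB_r_far
  | exact: GVB_r_braid | exact: GVB_s_far | exact: GVB_sr | exact: GVB_sr_far
  | exact: GVB_sr_mixed].
Qed.

(** * Normal form and faithfulness *)

Definition edge := {e : 'I_m.+1 * 'I_m.+1 | e.1 != e.2}.
Definition edge_refl (e : edge) : G := GVB_refl (val e).1 (val e).2.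
Definition edge_vec (e : edge) := basis_vec [set (val e).1; (val e).2].

Lemma edge_refl_faithful (w : seq edge) :
  GVB_mx (\prod_(e <- w) edge_refl e) = 1%:M%R -> \prod_(e <- w) edge_refl e = 1.
Proof.
(* The roots are basis vectors, so the sum of the coordinates is positive on each. *)
pose weight (h : {set 'I_m.+1}) : rat := 1%R.
apply: (@simply_laced_faithful _ _ _ _ _ _ edge_vec
  (\col_i weight (enum_val i))%R GVB_mx_repr).
- move=> [[a b] /= ab]; apply: (@refl_invol _ m) => //; [exact: GVB_r2
  | exact: GVB_r_far | exact: GVB_r_braid | exact: GVB_s2 | exact: GVB_sr
  | exact: GVB_sr_far | exact: GVB_sr_mixed].
- by move=> e; rewrite mul_basis_col ltr01.
- move=> [[a b] /= ab]; rewrite /edge_vec /edge_refl GVB_mx_refl //= mul_refl_mx.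
  by rewrite /cartan setIid cards2 ab scaler_nat mulr2n opprD addrA subrr sub0r.
by move=> [[a b] /= ab] [[c d] /= cd]; apply: GVB_coxeter_refl.
Qed.

(* On the span of the singletons, the simple roots of type A are the          *)
(* differences of consecutive basis vectors.                                  *)
Lemma perm_prod_faithful (v : seq 'I_m) :
  GVB_mx (\prod_(i <- v) GVB_r i) = 1%:M%R -> \prod_(i <- v) GVB_r i = 1.
Proof.
pose alpha k : 'rV_ #|{: {set 'I_m.+1}}| :=
  (basis_vec [set inord k] - basis_vec [set inord k.+1])%R.
(* The singleton of [a] gets height [-a], so every simple root has height [1]. *)
pose height (h : {set 'I_m.+1}) : rat := (- (\sum_(k in h) k)%:R)%R.
have vec_r k l : k < m -> (basis_vec [set inord l] *m GVB_mx (GVB_r k) =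
    basis_vec [set adj_tperm m k (inord l)])%R.
  by move=> km; rewrite GVB_mx_r // mul_perm_set_mx imset_set1.
have tpermE k l : k < m -> l <= m -> l != k -> l != k.+1 ->
    adj_tperm m k (inord l) = inord l.
  by move=> km lm lk lk1; rewrite tpermD // inord_eq //; rewrite ?(ltnW km) // eq_sym.
have near k : k.+1 < m ->
    (alpha k *m GVB_mx (GVB_r k.+1) = alpha k + alpha k.+1 /\
     alpha k.+1 *m GVB_mx (GVB_r k) = alpha k + alpha k.+1)%R.
  move=> km; rewrite !mulmxBl !vec_r //; try lia.
  rewrite (tpermE k.+1 k) ?(tpermE k k.+2); try lia.
  by rewrite !tpermL !tpermR /alpha addrA subrK.
apply: (@simply_laced_faithful _ _ _ _ _ (fun i : 'I_m => GVB_r i)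
  (fun i : 'I_m => alpha i) (\col_i height (enum_val i))%R GVB_mx_repr).
- by move=> i; apply: GVB_r2.
- move=> i; rewrite mulmxBl [ltRHS]mxE [X in (_ + X)%R]mxE !mul_basis_col.
  rewrite /height !big_set1 !inordK ?ltnS //; last exact: ltnW.
  by rewrite opprK addrC -natrB // subSnn ltr01.
- move=> i; rewrite mulmxBl !vec_r // tpermL tpermR opprB //.
have far k l : k < m -> l < m -> (k.+1 < l) || (l.+1 < k) ->
    coxeter_pair GVB_mx (GVB_r k) (GVB_r l) (alpha k) (alpha l).
  move=> km lm kl; apply: CoxeterComm; last first.
    case/orP: kl => kl; first exact: GVB_r_far.
    by apply: commute_sym; apply: GVB_r_far.
  by rewrite mulmxBl !vec_r // !tpermE //; lia.
move=> i j; have [im jm] := (ltn_ord i, ltn_ord j).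
have [ij|ij|/val_inj->] := ltngtP i j; last exact: CoxeterEq.
  have [ij1|ij1] := ltnP i.+1 j; first by apply: far; rewrite ?ij1.
  have eq_j : nat_of_ord j = i.+1 by lia.
  rewrite eq_j in jm *; have [nr nl] := near i jm.
  by apply: CoxeterBraid => //; apply: GVB_r_braid.
have [ij1|ij1] := ltnP j.+1 i; first by apply: far; rewrite ?ij1 ?orbT.
have eq_i : nat_of_ord i = j.+1 by lia.
rewrite eq_i in im *; have [nr nl] := near j im.
by apply: CoxeterBraid; rewrite 1?addrC // GVB_r_braid.
Qed.

Definition edge_move (k : nat) (e : edge) : edge :=
  exist _ (adj_tperm m k (val e).1, adj_tperm m k (val e).2)
    (etrans (congr1 negb (inj_eq perm_inj _ _)) (valP e)).

Lemma edge_refl_move k e : k < m ->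
  GVB_r k * edge_refl e = edge_refl (edge_move k e) * GVB_r k.
Proof.
case: e => [[a b] /= ab] km; rewrite /edge_refl /= /GVB_refl.
rewrite -refl_conj_adj //; try by [exact: GVB_r2
  | exact: GVB_r_far | exact: GVB_r_braid | exact: GVB_sr
  | exact: GVB_sr_far | exact: GVB_sr_mixed].
by rewrite conjgE (mulg1_eq (GVB_r2 km)) -!mulgA GVB_r2 // mulg1.
Qed.

(** Each [GVB_s i] is an edge reflection, and a [GVB_r i] on the left passes through the edge
    reflections by relabelling their edges. *)
Lemma GVB_normal_form (x : G) : exists (w : seq edge) (v : seq 'I_m),
  x = (\prod_(e <- w) edge_refl e) * (\prod_(i <- v) GVB_r i).
Proof.
elim/GVB_ind: x => [|i x [w [v ->]]|i x [w [v ->]]].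
- by exists [::], [::]; rewrite !big_nil mulg1.
- have ab : (inord i : 'I_m.+1) != inord i.+1.
    by rewrite inord_eq ?(ltnW (ltn_ord i)) // ltn_eqF.
  exists (exist _ (inord i, inord i.+1) ab :: w), v.
  by rewrite big_cons /edge_refl /= /GVB_refl refl_adj // mulgA.
exists [seq edge_move i e | e <- w], (i :: v); rewrite big_cons !mulgA.
congr (_ * _); elim: w => [|e w IHw]; first by rewrite !big_nil mulg1 mul1g.
by rewrite /= !big_cons mulgA edge_refl_move // -!mulgA IHw.
Qed.

Lemma GVB_mx_faithful x : GVB_mx x = 1%:M%R -> x = 1.
Proof.
have [w [v ->]] := GVB_normal_form x; rewrite GVB_mxM => wv1.
(* Edge reflections fix singletons, so these detect the permutation part alone. *)
have fix_singleton (a : 'I_m.+1) :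
    (basis_vec [set a] *m GVB_mx (\prod_(e <- w) edge_refl e)%g =
    basis_vec [set a])%R.
  elim: w {wv1} => [|[[b c] /= bc] w IHw]; first by rewrite big_nil GVB_mx1 mulmx1.
  rewrite big_cons GVB_mxM mulmxA [GVB_mx (edge_refl _)]GVB_mx_refl //.
  by rewrite mul_refl_mx /cartan cards1 scale0r subr0.
have [p vp] : exists p, GVB_mx (\prod_(i <- v) GVB_r i) = perm_set_mx p.
  elim: v {wv1} => [|i v [p vp]].
    by exists 1; rewrite big_nil GVB_mx1 perm_set_mx1.
  by exists (adj_tperm m i * p); rewrite big_cons GVB_mxM vp GVB_mx_r // perm_set_mxM.
have v1 : \prod_(i <- v) GVB_r i = 1.
  apply: perm_prod_faithful; rewrite vp (_ : p = 1) ?perm_set_mx1 //.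
  apply: perm_set_mx_faithful => a.
  by rewrite -{1}fix_singleton -mulmxA -vp wv1 mulmx1.
rewrite v1 mulg1; apply: edge_refl_faithful.
by rewrite -wv1 v1 GVB_mx1 mulmx1.
Qed.

End GaussGroup.

Theorem corollary5p8 (n : nat) (n_gt0 : 0 < n) : linear_group (GVB n).
Proof.
case: n n_gt0 => // m _; exists rat, _, (@GVB_mx m); split.
  exact: GVB_mx_repr.
move=> x y xy; apply/divg1_eq/GVB_mx_faithful.
by rewrite GVB_mxM xy -GVB_mxM mulgV GVB_mx1.
Qed.
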